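(* There exist graphs that are optimized on neither the quasi-star nor the quasi-clique: there exist a graph $H$ and $c\in[0,1]$ such that $$\limsup_{G\in\mathcal{C}_c\cap\mathcal{Q}}t(H,G)<\mathcal{M}_H(c)\quad\text{and}\quad\limsup_{G\in\mathcal{C}_c\cap\mathcal{S}}t(H,G)<\mathcal{M}_H(c),$$ where $\mathcal{Q}$ is the set of quasi-cliques and $\mathcal{S}$ is the set of quasi-stars. Moreover, such an $H$ can be taken to be connected and a threshold graph.
   Context: Graphs are finite and simple; $|G|$ is the number of vertices of $G$. $\hom(H,G)$ is the number of homomorphisms (edge-preserving vertex maps) from $H$ to $G$ and $t(H,G)=\hom(H,G)/|G|^{|H|}$. $\mathcal{C}_c=\{G:t(K_2,G)\le c\}$. For a class $\mathcal{C}$ of graphs, $\limsup_{G\in\mathcal{C}}f(G)=\lim_{n\to\infty}\sup\{f(G):G\in\mathcal{C},|G|\ge n\}$, and $\mathcal{M}_H(c)=\limsup_{G\in\mathcal{C}_c}t(H,G)$. A quasi-clique is a graph consisting of a clique together with isolated vertices (either part may be empty); a quasi-star is the complement of a quasi-clique. $N(u)$ is the neighborhood of $u$ and $\overline{N(u)}=N(u)\cup\{u\}$. A graph is a threshold graph if for any two vertices $u,v$ we have $N(u)\subseteq\overline{N(v)}$ or $N(v)\subseteq\overline{N(u)}$. *)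

(* Defs.v *)
From HB Require Import structures.
From mathcomp Require Import all_boot all_order all_algebra.
From mathcomp Require Import all_classical all_reals all_analysis.

Set Implicit Arguments.
Unset Strict Implicit.
Unset Printing Implicit Defensive.

Import Order.TTheory GRing.Theory Num.Theory.

Local Open Scope ring_scope.

Record sgraph : Type := SGraph {
  vertex :> finType;
  adj : rel vertex;
  adj_sym : symmetric adj;
  adj_irrefl : irreflexive adj }.

Lemma complete_rel_sym n : symmetric [rel x y : 'I_n | x != y].
Proof. by move=> x y /=; rewrite eq_sym. Qed.

Lemma complete_rel_irrefl n : irreflexive [rel x y : 'I_n | x != y].
Proof. by move=> x /=; rewrite eqxx. Qed.

Definition complete_graph (n : nat) : sgraph :=
  SGraph (@complete_rel_sym n) (@complete_rel_irrefl n).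

Definition compl_rel (G : sgraph) : rel G :=
  [rel x y | (x != y) && ~~ adj x y].

Lemma compl_rel_sym (G : sgraph) : symmetric (@compl_rel G).
Proof. by move=> x y; rewrite /compl_rel /= eq_sym adj_sym. Qed.

Lemma compl_rel_irrefl (G : sgraph) : irreflexive (@compl_rel G).
Proof. by move=> x; rewrite /compl_rel /= eqxx. Qed.

Definition compl_graph (G : sgraph) : sgraph :=
  SGraph (@compl_rel_sym G) (@compl_rel_irrefl G).

Definition is_hom (H G : sgraph) (f : {ffun H -> G}) : bool :=
  [forall x, forall y, adj x y ==> adj (f x) (f y)].

Definition hom (H G : sgraph) : nat := #|[set f : {ffun H -> G} | is_hom f]%SET|.

Definition hom_density (R : realType) (H G : sgraph) : R :=
  (hom H G)%:R / #|G|%:R ^+ #|H|.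

(* The type [set sgraph] is ruled out by a universe constraint between [set]
   and [finType]. *)
Definition graph_class := sgraph -> Prop.

Definition class_inter (C D : graph_class) : graph_class :=
  fun G => C G /\ D G.

Definition density_le (R : realType) (c : R) : graph_class :=
  fun G => hom_density R (complete_graph 2) G <= c.

(* The values lie in the extended reals, so that the supremum of an empty
   family is -oo. The sequence of suprema is nonincreasing, hence it always
   converges there. *)
Definition limsup_class (R : realType) (C : graph_class) (f : sgraph -> R)
  : \bar R :=
  limn (fun n : nat =>
    ereal_sup [set x | exists G : sgraph,
      [/\ C G, (n <= #|G|)%N & x = (f G)%:E]]%classic).

Definition max_density (R : realType) (H : sgraph) (c : R) : \bar R :=
  limsup_class (density_le c) (hom_density R H).

Definition quasi_clique : graph_class :=
  fun G => exists A : {set G},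
    forall x y : G, adj x y = [&& x != y, x \in A & y \in A].

Definition quasi_star : graph_class :=
  fun G => quasi_clique (compl_graph G).

Definition nbhd (G : sgraph) (u : G) : {set G} := [set v | adj u v]%SET.

Definition closed_nbhd (G : sgraph) (u : G) : {set G} := (u |: nbhd u)%SET.

Definition threshold_graph (G : sgraph) : Prop :=
  forall u v : G,
    nbhd u \subset closed_nbhd v \/ nbhd v \subset closed_nbhd u.

Definition connected_graph (G : sgraph) : Prop :=
  (0 < #|G|)%N /\ forall x y : G, connect (@adj G) x y.

(* Main.v *)
(* [H] is K_8 with 25 pendant edges attached to one vertex, and c = 3/8. The graph
   beating both families has 8N vertices, N of them dominating, 3N more completing
   them to a clique of order 4N, and 4N others. Mapping the pendant centre to a
   dominating vertex leaves the pendant vertices free, so its density tends to at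
   least 1/8 * (1/2)^7 = 2/2^11. In a quasi-star the dominating fraction is at most
   1/4 and at most one vertex of K_8 avoids it, which gives at most
   8 * (1/4)^7 = 1/2^11; in a quasi-clique the clique fraction is at most 3/4, which
   gives at most (3/4)^33 <= 1/2^11. *)

Require Import Defs.
From HB Require Import structures.
From mathcomp Require Import all_boot all_order all_algebra.
From mathcomp Require Import all_classical all_reals all_analysis.
From mathcomp Require Import zify ring lra.

Set Implicit Arguments.
Unset Strict Implicit.
Unset Printing Implicit Defensive.

Import Order.TTheory GRing.Theory Num.Theory.

Local Open Scope ring_scope.

(** * Counting maps and homomorphisms between finite sets *)

Lemma leq_card_bigcup (I T : finType) (P : pred I) (F : I -> {set T}) :
  (#|\bigcup_(i | P i) F i| <= \sum_(i | P i) #|F i|)%N.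
Proof.
elim/big_rec2: _ => [|i m A _ le_Am]; first by rewrite cards0.
by rewrite (leq_trans (leq_card_setU _ _)) ?leq_add2l.
Qed.

Lemma card_family_prod (aT rT : finType) (A : aT -> {set rT}) :
  #|[set f : {ffun aT -> rT} | [forall x, f x \in A x]]%SET| =
  (\prod_x #|A x|)%N.
Proof.
have -> : #|[set f : {ffun aT -> rT} | [forall x, f x \in A x]]%SET| =
          #|(family (fun x => mem (A x)) : {pred {ffun aT -> rT}})|.
  rewrite cardsE; apply: eq_card => f; rewrite !inE.
  by apply/forallP/familyP => fA x; have := fA x.
by rewrite card_family foldrE big_map big_enum.
Qed.

Lemma prod_nat_if (T : finType) (B : {set T}) (a b : nat) :
  (\prod_(x : T) (if x \in B then a else b) = a ^ #|B| * b ^ #|~: B|)%N.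
Proof.
rewrite (bigID (mem B)) /=; congr (_ * _)%N.
  by rewrite -prod_nat_const; apply: eq_bigr => x ->.
rewrite -prod_nat_const; apply: eq_big => [x|x /negbTE -> //].
by rewrite inE.
Qed.

Lemma card_ord_lt (n b : nat) : (b <= n)%N ->
  #|[set x : 'I_n | (x < b)%N]%SET| = b.
Proof.
by move=> le_bn; rewrite -sum1dep_card (big_ord_narrow le_bn) sum1_card card_ord.
Qed.

(* Overwriting [f y] keeps [f] recoverable, since [f y = f x]. *)
Lemma card_ffun_eq_at (aT rT : finType) (x y : aT) : x != y ->
  (#|rT| * #|[set f : {ffun aT -> rT} | f x == f y]%SET| <= #|rT| ^ #|aT|)%N.
Proof.
move=> neq_xy; set E := [set f : {ffun aT -> rT} | f x == f y]%SET.
rewrite -{1}cardsT -cardsX -card_ffun.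
pose upd (p : rT * {ffun aT -> rT}) : {ffun aT -> rT} :=
  [ffun z => if z == y then p.1 else p.2 z].
apply: (@leq_card_in _ _ upd) => -[v f] [w g].
rewrite !inE /= => /eqP fxy /eqP gxy /ffunP eq_upd.
have eqv : v = w by have := eq_upd y; rewrite !ffunE eqxx.
congr pair => //; apply/ffunP => z; case: (eqVneq z y) => [->|neq_zy].
  by have := eq_upd x; rewrite !ffunE (negbTE neq_xy) fxy gxy.
by have := eq_upd z; rewrite !ffunE (negbTE neq_zy).
Qed.

(* A union bound over the pairs of vertices of [H] that a noninjective map identifies. *)
Lemma leq_prod_card_hom (H G : sgraph) (A : H -> {set G}) :
  (forall f : {ffun H -> G},
     injective f -> (forall x, f x \in A x) -> is_hom f) ->
  (#|G| * \prod_x #|A x| <= #|G| * Defs.hom H G + #|H| ^ 2 * #|G| ^ #|H|)%N.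
Proof.
move=> homA.
pose E (p : H * H) := [set f : {ffun H -> G} | f p.1 == f p.2]%SET.
have subU : [set f : {ffun H -> G} | [forall x, f x \in A x]]%SET \subset
    [set f : {ffun H -> G} | is_hom f]%SET :|:
    \bigcup_(p : H * H | p.1 != p.2) E p.
  apply/fintype.subsetP => f; rewrite !inE => /forallP fA.
  have [/injectiveP f_inj|] := boolP (injectiveb f).
    by rewrite homA.
  case/injectivePn => x [y neq_xy eq_f]; apply/orP; right.
  by apply/bigcupP; exists (x, y) => //; rewrite inE /= eq_f.
rewrite -card_family_prod.
apply: leq_trans (leq_mul (leqnn #|G|) (subset_leq_card subU)) _.
apply: leq_trans (leq_mul (leqnn #|G|) (leq_card_setU _ _)) _.
rewrite mulnDr leq_add2l.
apply: leq_trans (leq_mul (leqnn #|G|) (leq_card_bigcup _ _)) _.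
rewrite big_distrr /=.
(* Each pair identifies at most [#|G| ^ (#|H| - 1)] maps; the factor [#|G|] carried along supplies
   the missing exponent. *)
apply: (@leq_trans (\sum_(p : H * H | p.1 != p.2) #|G| ^ #|H|)%N).
  by apply: leq_sum => p; apply: card_ffun_eq_at.
rewrite sum_nat_const leq_mul2r; apply/orP; right.
by rewrite (leq_trans (max_card _)) // card_prod -mulnn.
Qed.

(** * Edge counts and densities in natural numbers *)

Lemma hom_complete2 (G : sgraph) :
  Defs.hom (complete_graph 2) G = #|[set p : G * G | adj p.1 p.2]%SET|.
Proof.
pose ends (f : {ffun complete_graph 2 -> G}) :=
  (f (ord0 : 'I_2), f (lift ord0 ord0 : 'I_2)).
have ends_inj : injective ends.
  move=> f g [eq0 eq1]; apply/ffunP => x.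
  by case: (unliftP (ord0 : 'I_2) x) => [i ->|-> //]; rewrite (ord1 i).
rewrite /Defs.hom -(card_imset _ ends_inj); apply: eq_card => -[u v].
rewrite inE /=; apply/imsetP/idP => [[f]|adj_uv].
  rewrite inE => /forallP /(_ (ord0 : 'I_2)) /forallP.
  by move=> /(_ (lift ord0 ord0 : 'I_2)) /implyP f_hom [-> ->]; apply: f_hom.
exists [ffun x : 'I_2 => if x == ord0 then u else v]; last first.
  by rewrite /ends !ffunE.
rewrite inE; apply/forallP => x; apply/forallP => y; apply/implyP.
rewrite !ffunE /=; case: (unliftP (ord0 : 'I_2) x) => [i|] ->;
  case: (unliftP (ord0 : 'I_2) y) => [j|] -> //=.
  by rewrite (ord1 i) (ord1 j) eqxx.
by rewrite adj_sym.
Qed.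

(** Only diagonal pairs of [P] can fail to be edges, and there are at most [#|G|] of them. *)
Lemma leq_card_hom_complete2 (G : sgraph) (P : {set G * G}) :
  (forall p, p \in P -> p.1 != p.2 -> adj p.1 p.2) ->
  (#|P| <= Defs.hom (complete_graph 2) G + #|G|)%N.
Proof.
move=> adjP; rewrite hom_complete2.
have -> : #|G| = #|[set (x, x) | x in G]%SET|.
  by rewrite card_imset // => x y [].
apply: leq_trans (subset_leq_card _) (leq_card_setU _ _).
apply/fintype.subsetP => -[x y] Pxy; rewrite !inE /=.
have [<-|neq_xy] := eqVneq x y; last by rewrite (adjP _ Pxy).
by apply/orP; right; apply/imsetP; exists x.
Qed.

(** Clearing both denominators moves comparisons of densities into [nat]. *)
Lemma hom_density_le (R : realType) (H G : sgraph) (p q : nat) :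
  (0 < #|G|)%N -> (0 < q)%N ->
  (hom_density R H G <= p%:R / q%:R) = (Defs.hom H G * q <= p * #|G| ^ #|H|)%N.
Proof.
move=> G_gt0 q_gt0; rewrite /hom_density.
rewrite ler_pdivrMr ?exprn_gt0 ?ltr0n // mulrAC ler_pdivlMr ?ltr0n //.
by rewrite -natrX -!natrM ler_nat.
Qed.

Lemma hom_density_ge (R : realType) (H G : sgraph) (p q : nat) :
  (0 < #|G|)%N -> (0 < q)%N ->
  (p%:R / q%:R <= hom_density R H G) = (p * #|G| ^ #|H| <= Defs.hom H G * q)%N.
Proof.
move=> G_gt0 q_gt0; rewrite /hom_density.
rewrite ler_pdivlMr ?exprn_gt0 ?ltr0n // mulrAC ler_pdivrMr ?ltr0n //.
by rewrite -natrX -!natrM ler_nat.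
Qed.

(** * Bounds on limits superior over a class *)

Section LimsupClass.
Variables (R : realType) (C : graph_class) (f : sgraph -> R).

Let sup_tail (n : nat) : \bar R := ereal_sup [set x | exists G : sgraph,
  [/\ C G, (n <= #|G|)%N & x = (f G)%:E]]%classic.

Let is_cvg_sup_tail : cvgn sup_tail.
Proof.
apply: ereal_nonincreasing_is_cvgn => m n le_mn; apply: ereal_sup_le.
by move=> x [G [CG le_nG ->]]; exists G; split=> //; apply: leq_trans le_nG.
Qed.

Lemma limsup_class_le (x : R) (n0 : nat) :
  (forall G, C G -> (n0 <= #|G|)%N -> f G <= x) -> (limsup_class C f <= x%:E)%E.
Proof.
move=> f_le; apply: lime_le; first exact: is_cvg_sup_tail.
exists n0 => // n /= le_n0n; apply: ge_ereal_sup => _ [G [CG le_nG ->]].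
by rewrite lee_fin f_le // (leq_trans le_n0n).
Qed.

Lemma limsup_class_ge (x : R) :
  (forall n, exists G, [/\ C G, (n <= #|G|)%N & x <= f G]) ->
  (x%:E <= limsup_class C f)%E.
Proof.
move=> f_ge; apply: lime_ge; first exact: is_cvg_sup_tail.
exists 0%N => // n _ /=; have [G [CG le_nG le_xf]] := f_ge n.
by apply: le_ereal_sup_tmp; exists (f G)%:E; [exists G|rewrite lee_fin].
Qed.

End LimsupClass.

(** * Nested threshold graphs *)

Section NestedGraph.
Variables n a b : nat.

(** One family serves for both [H] and the graphs that beat the two classes: indices below [a]
    dominate, indices below [b] form a clique, the others see only the dominating vertices. *)
Definition nested_rel : rel 'I_n :=
  [rel x y : 'I_n | (x != y) && [|| x < a, y < a | (x < b) && (y < b)]%N].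

Lemma nested_rel_sym : symmetric nested_rel.
Proof. by move=> x y; rewrite /nested_rel /= eq_sym orbCA (andbC (y < b)%N). Qed.

Lemma nested_rel_irrefl : irreflexive nested_rel.
Proof. by move=> x; rewrite /nested_rel /= eqxx. Qed.

Definition nested_graph : sgraph := SGraph nested_rel_sym nested_rel_irrefl.

(** Up to the vertices themselves, neighborhoods shrink as the index grows. *)
Lemma threshold_nested_graph : threshold_graph nested_graph.
Proof.
have nbhd_sub (u v : 'I_n) : (v <= u)%N ->
    @nbhd nested_graph u \subset @closed_nbhd nested_graph v.
  move=> le_vu; apply/fintype.subsetP => x; rewrite !inE /= => /andP[_ ux].
  rewrite eq_sym; have [//|neq_vx] := eqVneq v x; rewrite /nested_rel /= neq_vx /=.
  lia.
by move=> u v; case/orP: (leq_total v u) => /nbhd_sub; [left|right].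
Qed.

End NestedGraph.

Lemma connected_nested_graph (n a b : nat) :
  (0 < a)%N -> connected_graph (nested_graph n.+1 a b).
Proof.
move=> a_gt0; split; first by rewrite card_ord.
pose z : nested_graph n.+1 a b := (ord0 : 'I_n.+1).
have conn_z x : connect (@adj (nested_graph n.+1 a b)) z x.
  case: (eqVneq z x) => [<-|neq_zx]; first exact: connect0.
  by apply: connect1; rewrite /= /nested_rel /= neq_zx a_gt0.
move=> x y; apply: connect_trans (conn_z y).
by rewrite (sym_connect_sym (@adj_sym _)) conn_z.
Qed.

(** An ordered edge starts in the dominating set [D], or only ends there, or has both ends in
    [B :\: D]. *)
Lemma hom_nested_edge_le (n a b : nat) : (a <= b <= n)%N ->
  (Defs.hom (complete_graph 2) (nested_graph n a b)
     <= a * n + (n - a) * a + (b - a) ^ 2)%N.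
Proof.
case/andP=> le_ab le_bn; rewrite hom_complete2.
pose D := [set x : 'I_n | (x < a)%N]%SET; pose B := [set x : 'I_n | (x < b)%N]%SET.
have cardD : #|D| = a by rewrite card_ord_lt // (leq_trans le_ab).
have cardBD : #|B :\: D| = (b - a)%N.
  rewrite cardsD (finset.setIidPr _) ?cardD ?card_ord_lt //.
  by apply/fintype.subsetP => x; rewrite !inE => /leq_trans->.
have <- : #|finset.setX D [set: 'I_n]| = (a * n)%N.
  by rewrite cardsX cardD cardsT card_ord.
have <- : #|finset.setX (~: D) D| = ((n - a) * a)%N.
  by rewrite cardsX cardsCs finset.setCK cardD card_ord.
have <- : #|finset.setX (B :\: D) (B :\: D)| = ((b - a) ^ 2)%N.
  by rewrite cardsX cardBD mulnn.
apply: leq_trans (leq_add (leq_card_setU _ _) (leqnn _)).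
apply: leq_trans (leq_card_setU _ _).
apply: subset_leq_card; apply/fintype.subsetP => -[x y].
rewrite !inE /= /nested_rel /= => /andP[_ adj_xy]; lia.
Qed.

(** The centre may go to any dominating vertex, its [k] clique partners to any index below [b], and
    the [m] pendant vertices anywhere. The last summand pays for the noninjective choices. *)
Lemma hom_nested_ge (k m n a b : nat) : (a <= b <= n)%N ->
  (n * (a * (b ^ k * n ^ m)) <=
   n * Defs.hom (nested_graph (k + m).+1 1 k.+1) (nested_graph n a b)
     + (k + m).+1 ^ 2 * n ^ (k + m).+1)%N.
Proof.
case/andP=> le_ab le_bn.
pose bound (x : 'I_(k + m).+1) := if x == ord0 then a else if (x < k.+1)%N then b else n.
have bound_le x : (bound x <= n)%N.
  by rewrite /bound; do 2?case: ifP => _; rewrite ?(leq_trans le_ab).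
pose A (x : nested_graph (k + m).+1 1 k.+1) : {set nested_graph n a b} :=
  [set v : 'I_n | (v < bound x)%N]%SET.
have := @leq_prod_card_hom (nested_graph (k + m).+1 1 k.+1) (nested_graph n a b) A.
rewrite !card_ord; suff -> : (\prod_x #|A x| = a * (b ^ k * n ^ m))%N.
  apply=> f f_inj fA.
  have lt_f (x : 'I_(k + m).+1) :
      ((x < 1)%N ==> (f x < a)%N) && ((x < k.+1)%N ==> (f x < b)%N).
    have := fA x; rewrite inE /bound -val_eqE /=.
    by case: (nat_of_ord x) => [|i] /=; [|case: ifP]; lia.
  apply/forallP => x; apply/forallP => y; apply/implyP.
  (* Injectivity gives [f x != f y]; a truth table over the eight comparisons remains. *)
  rewrite /= /nested_rel /= (inj_eq f_inj) => /andP[-> /=].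
  by move: (lt_f x) (lt_f y); do 8!case: (_ < _)%N.
rewrite (eq_bigr bound) => [|x _]; last by rewrite card_ord_lt.
rewrite big_ord_recl {1}/bound eqxx; congr (_ * _)%N.
pose K := [set x : 'I_(k + m) | (x < k)%N]%SET.
rewrite (eq_bigr (fun x => if x \in K then b else n)) => [|x _]; last first.
  by rewrite /bound inE.
have cardK : #|K| = k by rewrite card_ord_lt // leq_addr.
by rewrite prod_nat_if (cardsCs (~: K)) finset.setCK cardK card_ord addKn.
Qed.

(** * Upper bounds on homomorphism counts *)

Lemma hom_le_clique (H G : sgraph) (A : {set G}) :
  (forall x : H, exists y, adj x y) -> (forall u v : G, adj u v -> u \in A) ->
  (Defs.hom H G <= #|A| ^ #|H|)%N.
Proof.
move=> H_adj A_adj; rewrite -prod_nat_const -card_family_prod.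
apply: subset_leq_card; apply/fintype.subsetP => f; rewrite !inE => /forallP f_hom.
apply/forallP => x; have [y adj_xy] := H_adj x.
by apply: A_adj (f y) _; have /forallP/(_ y)/implyP := f_hom x; apply.
Qed.

(* At most one vertex of the clique [K] is mapped into the independent set [A]. *)
Lemma hom_le_independent (H G : sgraph) (K : {set H}) (A : {set G}) :
  (0 < #|K|)%N -> {in K &, forall x y, x != y -> adj x y} ->
  {in A &, forall u v, ~~ adj u v} ->
  (Defs.hom H G
     <= #|K| * (#|~: A| ^ #|K|.-1 * #|G| ^ (#|H| - #|K|.-1)))%N.
Proof.
move=> /card_gt0P[x0 Kx0] K_clique A_indep.
pose F (x y : H) : {set G} := if y \in K :\ x then ~: A else [set: G].
rewrite -sum_nat_const.
apply: leq_trans (_ : _ <= #|\bigcup_(x in K)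
    [set f : {ffun H -> G} | [forall y, f y \in F x y]]%SET|)%N _; last first.
  apply: leq_trans (leq_card_bigcup _ _) _; apply: leq_sum => x Kx.
  have cardKx : #|K :\ x| = #|K|.-1 by rewrite (cardsD1 x K) Kx.
  rewrite card_family_prod -{}cardKx.
  rewrite (eq_bigr (fun y => if y \in K :\ x then #|~: A| else #|G|)).
    by rewrite prod_nat_if (cardsCs (~: (K :\ x))) finset.setCK.
  by move=> y _; rewrite /F; case: ifP; rewrite // cardsT.
apply: subset_leq_card; apply/fintype.subsetP => f; rewrite inE => /forallP f_hom.
(* The vertex of [K] sent into [A], if there is one, indexes the union; otherwise any vertex of [K]
   does. *)
have [/existsP[x /andP[Kx Afx]]|] := boolP [exists x in K, f x \in A].
  apply/bigcupP; exists x => //; rewrite inE; apply/forallP => y.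
  rewrite /F; case: ifP; rewrite !inE // => /andP[neq_yx Ky].
  apply: contraL (K_clique _ _ Ky Kx neq_yx) => Afy.
  apply: contra (A_indep _ _ Afy Afx).
  by have /forallP/(_ x)/implyP := f_hom y.
rewrite negb_exists => /forallP noA.
apply/bigcupP; exists x0 => //; rewrite inE; apply/forallP => y.
rewrite /F; case: ifP; rewrite !inE // => /andP[_ Ky].
by have := noA y; rewrite Ky.
Qed.

(** * The pendant clique at edge density 3/8 *)

Lemma density_le_edges (R : realType) (G : sgraph) : (0 < #|G|)%N ->
  density_le (3%:R / 8%:R : R) G ->
  (Defs.hom (complete_graph 2) G * 8 <= 3 * #|G| ^ 2)%N.
Proof. by move=> G_gt0; rewrite /density_le hom_density_le // card_ord. Qed.

(** Vertex 0 is the centre, 1 to 7 complete K_8, and the other 25 are pendant; the order is split as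
    in [hom_nested_ge]. *)
Definition pendant_clique : sgraph := nested_graph (7 + 25).+1 1 8.

Lemma hom_quasi_clique_le (R : realType) (G : sgraph) :
  density_le (3%:R / 8%:R : R) G -> quasi_clique G -> (17 <= #|G|)%N ->
  (Defs.hom pendant_clique G * 2 ^ 11 <= 1 * #|G| ^ #|pendant_clique|)%N.
Proof.
move=> dens [A adjA] G_ge17.
have {dens} := density_le_edges (leq_trans _ G_ge17) dens => /(_ isT) edges_le.
have : (#|finset.setX A A| <= Defs.hom (complete_graph 2) G + #|G|)%N.
  apply: leq_card_hom_complete2 => -[u v]; rewrite inE /= adjA.
  by case/andP=> -> -> ->.
rewrite cardsX => A_le.
(* With n = [#|G|], [#|A|] squared is at most 3/8 n^2 + n, which is below 9/16 n^2 for n >= 17. *)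
have A_le34 : (4 * #|A| <= 3 * #|G|)%N by nia.
(* The centre is a neighbor of every other vertex, and vertex 1 is a neighbor of the centre. *)
have pc_adj (x : pendant_clique) : exists y, adj x y.
  have [neq_x0|eq_x0] := boolP (x != (ord0 : 'I_33)).
    by exists (ord0 : 'I_33); rewrite /= /nested_rel /= neq_x0 orbT.
  exists (lift ord0 ord0 : 'I_33); rewrite /= /nested_rel /=.
  by move/negPn/eqP: eq_x0 => ->.
have A_adj u v : adj u v -> u \in A by rewrite adjA => /and3P[].
have := hom_le_clique pc_adj A_adj; rewrite card_ord mul1n => hom_le.
apply: leq_trans (leq_mul hom_le (leqnn _)) _.
(* As 33 = 3 * 11, it suffices to compare eleventh roots, where 2 * (3/4)^3 = 27/32 < 1. *)
rewrite (expnM _ 3 11 : (#|A| ^ (7 + 25).+1 = _)%N).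
rewrite (expnM _ 3 11 : (#|G| ^ (7 + 25).+1 = _)%N) -expnMn leq_exp2r //.
nia.
Qed.

Lemma hom_quasi_star_le (R : realType) (G : sgraph) :
  density_le (3%:R / 8%:R : R) G -> quasi_star G -> (17 <= #|G|)%N ->
  (Defs.hom pendant_clique G * 2 ^ 11 <= 1 * #|G| ^ #|pendant_clique|)%N.
Proof.
move=> dens star_G G_ge17.
have [A adjA] : exists A : {set G}, forall u v : G,
  (u != v) && ~~ adj u v = [&& u != v, u \in A & v \in A] := star_G.
have {dens} := density_le_edges (leq_trans _ G_ge17) dens => /(_ isT) edges_le.
have : (#|~: finset.setX A A| <= Defs.hom (complete_graph 2) G + #|G|)%N.
  apply: leq_card_hom_complete2 => -[u v]; rewrite !inE /= => /negbTE notA neq_uv.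
  by have := adjA u v; rewrite neq_uv notA /= => /negPn.
rewrite cardsCs finset.setCK cardsX card_prod => A_le.
(* With n = [#|G|], [#|A|] squared is at least 5/8 n^2 - n, and this is at least 9/16 n^2 once n >=
   16. *)
have A_ge34 : (3 * #|G| <= 4 * #|A|)%N by nia.
have S_le : (4 * #|~: A| <= #|G|)%N by have := cardsC A; lia.
pose K : {set pendant_clique} := [set x : 'I_(7 + 25).+1 | (x < 8)%N]%SET.
have cardK : #|K| = 8 by rewrite card_ord_lt.
have K_clique : {in K &, forall x y : pendant_clique, x != y -> adj x y}.
  by move=> x y; rewrite !inE /= /nested_rel /= => -> -> ->; rewrite !orbT.
have A_indep : {in A &, forall u v, ~~ adj u v}.
  move=> u v Au Av; have [->|neq_uv] := eqVneq u v; first by rewrite adj_irrefl.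
  by have := adjA u v; rewrite neq_uv Au Av.
have K_gt0 : (0 < #|K|)%N by rewrite cardK.
have := hom_le_independent K_gt0 K_clique A_indep; rewrite cardK card_ord mul1n.
move=> hom_le; apply: leq_trans (leq_mul hom_le (leqnn _)) _.
(* Since 8 * 2^11 = 4^7, the constants are absorbed into the seven factors [#|~: A|]. *)
have -> : (8 * (#|~: A| ^ 7 * #|G| ^ ((7 + 25).+1 - 7)) * 2 ^ 11 =
           (4 * #|~: A|) ^ 7 * #|G| ^ 26)%N.
  rewrite expnMn (_ : 4 = 2 ^ 2)%N // -expnM (expnD 2 3 11 : (2 ^ (2 * 7) = _)%N).
  by rewrite mulnAC mulnA.
by rewrite (expnD #|G| 7 26 : (#|G| ^ (7 + 25).+1 = _)%N) leq_mul2r leq_exp2r ?S_le ?orbT.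
Qed.

(** The main term has density 1/8 * (1/2)^7 = 4/2^12. For such [N] the noninjective maps cost at
    most a quarter of it. *)
Lemma hom_nested_optimum_ge (N : nat) : (2 ^ 12 * 33 ^ 2 <= N)%N ->
  (3 * (8 * N) ^ (7 + 25).+1 <=
   Defs.hom pendant_clique (nested_graph (8 * N) N (4 * N)) * 2 ^ 12)%N.
Proof.
move=> N_ge; have N_gt0 : (0 < N)%N by apply: leq_trans N_ge; rewrite muln_gt0 !expn_gt0.
have := @hom_nested_ge 7 25 (8 * N) N (4 * N).
rewrite -/pendant_clique; set h := Defs.hom _ _.
have -> : (N <= 4 * N <= 8 * N)%N by lia.
move=> /(_ isT).
(* 2^10 = 8 * 2^7 clears the fractions 1/8 and (1/2)^7. *)
have eq8 : (2 ^ 10 * (N * (4 * N) ^ 7) = (8 * N) ^ 8)%N.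
  rewrite (_ : 8 = 2 * 4)%N // -mulnA (expnMn 2) (expnS (4 * N) 7).
  by rewrite (expnD 2 8 2 : (2 ^ 10 = _)%N) -!mulnA.
have pow_eq : (2 ^ 10 * (N * ((4 * N) ^ 7 * (8 * N) ^ 25)) = (8 * N) ^ 33)%N.
  by rewrite (expnD _ 8 25 : ((8 * N) ^ 33 = _)%N) -eq8 !mulnA.
have powS : ((8 * N) ^ 33 = 8 * N * (8 * N) ^ 32)%N by exact: expnS.
rewrite {}powS in pow_eq *; move: pow_eq.
move: ((8 * N) ^ 32)%N (N * _)%N => P S pow_eq main.
have {pow_eq}main : (8 * N * P <= 2 ^ 10 * h + 2 ^ 10 * 33 ^ 2 * P)%N.
  rewrite -(@leq_pmul2l (8 * N)%N) ?muln_gt0 // -[X in (_ * X <= _)%N]pow_eq.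
  rewrite mulnCA; apply: leq_trans (leq_mul (leqnn _) main) _.
  by apply: eq_leq; move: (2 ^ 10)%N (33 ^ 2)%N => T C; ring.
have error_le : (4 * (2 ^ 10 * 33 ^ 2) * P <= 8 * N * P)%N.
  by rewrite leq_mul2r mulnA (leq_trans N_ge) ?orbT // leq_pmull.
rewrite (_ : 2 ^ 12 = 4 * 2 ^ 10)%N //.
move: (2 ^ 10 * 33 ^ 2)%N (2 ^ 10)%N main error_le => E T; nia.
Qed.

Theorem corollary4p5 (R : realType) :
  exists (H : sgraph) (c : R),
    [/\ connected_graph H, threshold_graph H, 0 <= c <= 1,
        (limsup_class (class_inter (density_le c) quasi_clique) (hom_density R H)
           < max_density H c)%E
      & (limsup_class (class_inter (density_le c) quasi_star) (hom_density R H)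
           < max_density H c)%E].
Proof.
have exp_gt0 k : (0 < 2 ^ k)%N by rewrite expn_gt0.
have lt_bounds : ((1%:R / (2 ^ 11)%:R : R)%:E < (3%:R / (2 ^ 12)%:R : R)%:E)%E.
  rewrite lte_fin (expnS 2 11) natrM invfM mulrA ltr_pM2r ?invr_gt0 ?ltr0n //.
  lra.
have optimum_ge :
    ((3%:R / (2 ^ 12)%:R : R)%:E <= max_density pendant_clique (3%:R / 8%:R : R))%E.
  (* This [N] exceeds both the required order and the threshold for the error term. *)
  apply: limsup_class_ge => n; pose N := (n + 2 ^ 12 * 33 ^ 2)%N.
  have N_gt0 : (0 < N)%N by rewrite addn_gt0 muln_gt0 !expn_gt0 orbT.
  exists (nested_graph (8 * N) N (4 * N)); split.
  - rewrite /density_le hom_density_le ?card_ord ?muln_gt0 //.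
    (* The edge bound 8N^2 + 7N^2 + 9N^2 = 24N^2 is exactly 3/8 of (8N)^2. *)
    have := @hom_nested_edge_le (8 * N) N (4 * N).
    have -> : (N <= 4 * N <= 8 * N)%N by lia.
    by move=> /(_ isT) edges_le; rewrite -mulnn; move: edges_le; clearbody N; nia.
  - by rewrite card_ord (leq_trans (leq_addr _ _ : n <= N)%N) // leq_pmull.
  rewrite hom_density_ge ?card_ord ?muln_gt0 //.
  by apply: hom_nested_optimum_ge; apply: leq_addl.
exists pendant_clique, (3%:R / 8%:R); split.
- exact: connected_nested_graph.
- exact: threshold_nested_graph.
- by apply/andP; split; lra.
- apply: le_lt_trans (lt_le_trans lt_bounds optimum_ge).
  apply: (@limsup_class_le _ _ _ _ 17) => G [G_dens G_clique] G_ge17.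
  rewrite hom_density_le ?(leq_trans _ G_ge17) //.
  exact: hom_quasi_clique_le G_dens G_clique G_ge17.
- apply: le_lt_trans (lt_le_trans lt_bounds optimum_ge).
  apply: (@limsup_class_le _ _ _ _ 17) => G [G_dens G_star] G_ge17.
  rewrite hom_density_le ?(leq_trans _ G_ge17) //.
  exact: hom_quasi_star_le G_dens G_star G_ge17.
Qed.
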